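(* Let $n\ge2$. Let $B(1):=B(\infty,\infty,n)$ and, inductively for $i\ge1$, define the amalgamated product $B(i+1):=B(i)*_{B(B_{n-1})}B(\infty,\infty,n)$ over the finite-type Artin group $B(B_{n-1})$. Then, for every integer $k\ge2$, the group $B^{(k)}(\infty,\infty,n)$ is isomorphic to $B(k)$.
   Context: For $k\in\mathbb{Z}\setminus\{0\}$, $B^{\oplus k}(\infty,\infty,n)$ is the monoid presented by generators $\tilde t_i$ ($i\in\mathbb{Z}$), $\tilde s_3,\dots,\tilde s_n$ and relations: $\tilde s_i\tilde s_j\tilde s_i=\tilde s_j\tilde s_i\tilde s_j$ for $|i-j|=1$; $\tilde s_i\tilde s_j=\tilde s_j\tilde s_i$ for $|i-j|>1$; $\tilde s_3\tilde t_i\tilde s_3=\tilde t_i\tilde s_3\tilde t_i$ for $i\in\mathbb{Z}$; $\tilde s_j\tilde t_i=\tilde t_i\tilde s_j$ for $i\in\mathbb{Z}$ and $4\le j\le n$; $\tilde t_i\tilde t_{i-k}=\tilde t_j\tilde t_{j-k}$ for $i,j\in\mathbb{Z}$. This is a Garside monoid (in particular cancellative with common multiples), and $B^{(k)}(\infty,\infty,n)$ denotes its group of fractions, i.e. the group given by the same presentation. $B(\infty,\infty,n)$ is the group presented by generators $\tilde t_0,\tilde t_1,\tilde s_3,\dots,\tilde s_n$ and relations: $\tilde s_i\tilde s_{i+1}\tilde s_i=\tilde s_{i+1}\tilde s_i\tilde s_{i+1}$ for $3\le i\le n-1$; $\tilde s_i\tilde s_j=\tilde s_j\tilde s_i$ for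 $|i-j|>1$; $\tilde s_3\tilde t_i\tilde s_3=\tilde t_i\tilde s_3\tilde t_i$ for $i=0,1$; $\tilde s_j\tilde t_i=\tilde t_i\tilde s_j$ for $i=0,1$ and $4\le j\le n$; $\tilde s_3\tilde t_1\tilde t_0\tilde s_3\tilde t_1\tilde t_0=\tilde t_1\tilde t_0\tilde s_3\tilde t_1\tilde t_0\tilde s_3$ (no relations if $n=2$). By a result of Corran–Lee–Lee it is also presented by generators $\tilde t_i$ ($i\in\mathbb{Z}$), $\tilde s_3,\dots,\tilde s_n$ and the relations listed above for $k=1$. $B(B_{n-1})$ is the Artin group with generators $q_1,\dots,q_{n-1}$ and relations $q_1q_2q_1q_2=q_2q_1q_2q_1$, $q_iq_{i+1}q_i=q_{i+1}q_iq_{i+1}$ for $2\le i\le n-2$, and $q_iq_j=q_jq_i$ for $|i-j|>1$. It embeds in $B(\infty,\infty,n)$ by $q_1\mapsto\tilde t_1\tilde t_0$, $q_j\mapsto\tilde s_{j+1}$ ($2\le j\le n-1$). The amalgamations are taken along this embedding into each copy of $B(\infty,\infty,n)$ (for $B(i)$, through any of the copies of $B(\infty,\infty,n)$ composing it, the images being identified). *)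

(* Defs.v *)
From HB Require Import structures.
From mathcomp Require Import all_boot all_order ssralg ssrnum ssrint.
From mathcomp Require Import boolp.
Set Implicit Arguments.
Unset Strict Implicit.
Unset Printing Implicit Defensive.

Local Open Scope quotient_scope.
Local Open Scope group_scope.

(* [R u v] reads "u = v is a defining relation".  The sides are words in the
   generators only; inverses are not needed in any presentation below. *)
Definition relations (X : Type) := seq X -> seq X -> Prop.

Section PresentedGroup.
Variables (X : choiceType) (R : relations X).

(* The letter [(x, false)] stands for x and [(x, true)] for its inverse. *)
Definition word := seq (X * bool).
Definition positive (u : seq X) : word := [seq (x, false) | x <- u].
Definition winv (w : word) : word := rev [seq (a.1, ~~ a.2) | a <- w].

(* The congruence whose classes are the cosets of the normal closure of the
   relators in the free group on X. *)
Inductive word_eq : word -> word -> Prop :=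
| WRefl u : word_eq u u
| WSym u v : word_eq u v -> word_eq v u
| WTrans u v w : word_eq u v -> word_eq v w -> word_eq u w
| WCat u u' v v' : word_eq u u' -> word_eq v v' -> word_eq (u ++ v) (u' ++ v')
| WCancel x b : word_eq [:: (x, b); (x, ~~ b)] [::]
| WRel u v : R u v -> word_eq (positive u) (positive v).

Definition word_eqb (u v : word) : bool := `[< word_eq u v >].

Fact word_eqb_equiv : equiv_class_of word_eqb.
Proof.
split=> [u|u v|v u w].
- by apply/asboolP; apply: WRefl.
- by apply/asboolP/asboolP; apply: WSym.
- by move=> /asboolP uv /asboolP vw; apply/asboolP; apply: WTrans vw.
Qed.

Canonical word_equiv := EquivRelPack word_eqb_equiv.

Definition presented := {eq_quot word_equiv}.

HB.instance Definition _ := Choice.on presented.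
HB.instance Definition _ := EqQuotient.on presented.

Definition wclass (w : word) : presented := \pi w.

Lemma wclassP u v : wclass u = wclass v <-> word_eq u v.
Proof. by split=> [/eqmodP/asboolP|uv]; last by apply/eqmodP/asboolP. Qed.

Lemma wclassK x : wclass (repr x) = x.
Proof. exact: reprK. Qed.

Lemma repr_wclass w : word_eq (repr (wclass w)) w.
Proof. by apply/wclassP; rewrite wclassK. Qed.

Lemma winv_cat u v : winv (u ++ v) = winv v ++ winv u.
Proof. by rewrite /winv map_cat rev_cat. Qed.

Lemma winvK : involutive winv.
Proof.
move=> w; rewrite /winv map_rev revK -map_comp -[RHS]map_id.
by apply: eq_map => -[x b] /=; rewrite negbK.
Qed.

Lemma word_eqVr w : word_eq (w ++ winv w) [::].
Proof.
elim: w => [|[x b] w IHw]; first exact: WRefl.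
rewrite -cat1s winv_cat -catA [w ++ _]catA.
apply: WTrans (WCancel x b).
exact: (WCat (WRefl [:: (x, b)]) (WCat IHw (WRefl [:: (x, ~~ b)]))).
Qed.

Lemma word_eqVl w : word_eq (winv w ++ w) [::].
Proof. by rewrite -[X in _ ++ X]winvK; apply: word_eqVr. Qed.

Lemma word_eqV u v : word_eq u v -> word_eq (winv u) (winv v).
Proof.
move=> uv; rewrite -[winv u]cats0.
apply: WTrans (WCat (WRefl _) (WSym (word_eqVr v))) _; rewrite catA.
apply: WTrans (WCat (WCat (WRefl _) (WSym uv)) (WRefl _)) _.
exact: (WCat (word_eqVl u) (WRefl _)).
Qed.

Definition pmul (x y : presented) := wclass (repr x ++ repr y).
Definition pone : presented := wclass [::].
Definition pinv (x : presented) := wclass (winv (repr x)).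

Lemma wclassM u v : pmul (wclass u) (wclass v) = wclass (u ++ v).
Proof. by apply/wclassP; apply: WCat; apply: repr_wclass. Qed.

Lemma wclassV u : pinv (wclass u) = wclass (winv u).
Proof. by apply/wclassP; apply: word_eqV; apply: repr_wclass. Qed.

Fact pmulA : associative pmul.
Proof.
move=> x y z; rewrite -[x]wclassK -[y]wclassK -[z]wclassK.
by rewrite !wclassM catA.
Qed.

Fact pmul1 : left_id pone pmul.
Proof. by move=> x; rewrite -[x]wclassK wclassM. Qed.

Fact pmulr1 : right_id pone pmul.
Proof. by move=> x; rewrite -[x]wclassK wclassM cats0. Qed.

Fact pmulV : left_inverse pone pinv pmul.
Proof.
by move=> x; rewrite -[x]wclassK wclassV wclassM; apply/wclassP/word_eqVl.
Qed.

Fact pmulrV : right_inverse pone pinv pmul.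
Proof.
by move=> x; rewrite -[x]wclassK wclassV wclassM; apply/wclassP/word_eqVr.
Qed.

HB.instance Definition _ :=
  isGroup.Build presented pmulA pmul1 pmulr1 pmulV pmulrV.

Definition pgen (x : X) : presented := wclass [:: (x, false)].

Lemma prod_pgen (u : seq X) : \prod_(x <- u) pgen x = wclass (positive u).
Proof.
elim: u => [|x u IHu]; first by rewrite big_nil.
by rewrite big_cons IHu; apply: wclassM.
Qed.

Lemma pgen_rel (u v : seq X) :
  R u v -> \prod_(x <- u) pgen x = \prod_(x <- v) pgen x.
Proof. by move=> Ruv; rewrite !prod_pgen; apply/wclassP/WRel. Qed.

Section Lift.
Variables (G : groupType) (f : X -> G).
Hypothesis fR : forall u v, R u v -> \prod_(x <- u) f x = \prod_(x <- v) f x.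

Definition weval (w : word) : G :=
  \prod_(a <- w) (if a.2 then (f a.1)^-1 else f a.1).

Lemma weval_eq u v : word_eq u v -> weval u = weval v.
Proof.
elim=> {u v} [//|//|u v w _ -> _ -> //|u u' v v' _ IHu _ IHv|x b|u v /fR].
- by rewrite /weval !big_cat; congr (_ * _).
- rewrite /weval big_cons big_seq1 big_nil /=.
  by case: b => /=; rewrite ?mulgV ?mulVg.
- by rewrite /weval !big_map.
Qed.

Definition plift_def (x : presented) : G := weval (repr x).

Fact plift_monoid_morphism : monoid_morphism plift_def.
Proof.
split=> [|x y]; rewrite /plift_def (weval_eq (repr_wclass _)) /weval.
  by rewrite big_nil.
by rewrite big_cat.
Qed.

HB.instance Definition _ :=
  isUMagmaMorphism.Build presented G plift_def plift_monoid_morphism.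

Definition plift : {multiplicative presented -> G} := plift_def.

Lemma plift_gen x : plift (pgen x) = f x.
Proof. by rewrite /= /plift_def (weval_eq (repr_wclass _)) /weval big_seq1. Qed.
End Lift.

End PresentedGroup.

Definition isomorphic (G H : groupType) : Prop :=
  exists f : {multiplicative G -> H}, bijective f.

Section Amalgam.
Variables (A G H : groupType).
Variables (phi : {multiplicative A -> G}) (psi : {multiplicative A -> H}).

(* The multiplication tables of G and H present the free product G * H; the
   last relations identify the two images of A.  This is the amalgamated
   product of G and H over A when phi and psi are injective. *)
Inductive amalgam_rel : relations (G + H)%type :=
| AmalgL g g' : amalgam_rel [:: inl g; inl g'] [:: inl (g * g')]
| AmalgR h h' : amalgam_rel [:: inr h; inr h'] [:: inr (h * h')]
| AmalgLR a : amalgam_rel [:: inl (phi a)] [:: inr (psi a)].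

Definition amalgam : groupType := presented amalgam_rel.

Definition amalgam_inr (h : H) : amalgam := pgen amalgam_rel (inr h).

Lemma amalgam_glue a :
  pgen amalgam_rel (inl (phi a)) = amalgam_inr (psi a).
Proof. by have := pgen_rel (AmalgLR a); rewrite !big_seq1. Qed.

Fact amalgam_inr_morph : {morph amalgam_inr : x y / x * y}.
Proof.
move=> x y; have := pgen_rel (AmalgR x y).
by rewrite big_cons !big_seq1 => /esym.
Qed.

HB.instance Definition _ :=
  isMultiplicative.Build H amalgam amalgam_inr amalgam_inr_morph.

End Amalgam.

Section BraidGroups.
Variable n : nat.

Definition s_index := {j : nat | (3 <= j <= n)%N}.
Definition q_index := {j : nat | (1 <= j < n)%N}.

Section Common.
(* The generators are t_i (i : I), written [inl i], and s_3, ..., s_n, written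
   [inr j]. *)
Variable I : choiceType.

Inductive common_rel : relations (I + s_index)%type :=
| SBraid (i j : s_index) : `|val i - val j|%N = 1%N ->
    common_rel [:: inr i; inr j; inr i] [:: inr j; inr i; inr j]
| SComm (i j : s_index) : (`|val i - val j| > 1)%N ->
    common_rel [:: inr i; inr j] [:: inr j; inr i]
| STBraid (j : s_index) (i : I) : val j = 3%N ->
    common_rel [:: inr j; inl i; inr j] [:: inl i; inr j; inl i]
| STComm (j : s_index) (i : I) : (4 <= val j)%N ->
    common_rel [:: inr j; inl i] [:: inl i; inr j].
End Common.

Inductive Bk_rel (k : int) : relations (int + s_index)%type :=
| BkCommon u v : common_rel u v -> Bk_rel k u v
| BkT (i j : int) :
    Bk_rel k [:: inl i; inl (i - k)%R] [:: inl j; inl (j - k)%R].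

(* B^(k)(oo,oo,n), the enveloping group of the monoid with the same
   presentation; meaningful for k != 0. *)
Definition Bk (k : int) : groupType := presented (Bk_rel k).

Definition t0 : ('I_2 + s_index)%type := inl ord0.
Definition t1 : ('I_2 + s_index)%type := inl ord_max.

Inductive Boo_rel : relations ('I_2 + s_index)%type :=
| BooCommon u v : common_rel u v -> Boo_rel u v
| BooT (j : s_index) : val j = 3%N ->
    Boo_rel [:: inr j; t1; t0; inr j; t1; t0] [:: t1; t0; inr j; t1; t0; inr j].

(* B(oo,oo,n) *)
Definition Boo : groupType := presented Boo_rel.

Inductive BB_rel : relations q_index :=
| BB12 (i j : q_index) : val i = 1%N -> val j = 2%N ->
    BB_rel [:: i; j; i; j] [:: j; i; j; i]
| BBBraid (i j : q_index) : (2 <= val i)%N -> val j = (val i).+1 ->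
    BB_rel [:: i; j; i] [:: j; i; j]
| BBComm (i j : q_index) : (`|val i - val j| > 1)%N ->
    BB_rel [:: i; j] [:: j; i].

(* B(B_{n-1}) *)
Definition BB : groupType := presented BB_rel.

(* q_1 |-> t_1 t_0 and q_j |-> s_{j+1} otherwise: since 1 <= j < n, the index
   j + 1 fails to lie in {3, ..., n} exactly when j = 1. *)
Definition q_image (j : q_index) : Boo :=
  if insub (val j).+1 is Some i then pgen Boo_rel (inr i)
  else pgen Boo_rel t1 * pgen Boo_rel t0.

Lemma q_image1 (j : q_index) :
  val j = 1%N -> q_image j = pgen Boo_rel t1 * pgen Boo_rel t0.
Proof. by rewrite /q_image => ->; rewrite insubF. Qed.

Lemma q_imageS (j : q_index) : (1 < val j)%N ->
  exists2 i : s_index, val i = (val j).+1 & q_image j = pgen Boo_rel (inr i).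
Proof.
move=> j_gt1; have lt : (3 <= (val j).+1 <= n)%N.
  by case/andP: (valP j) => _ jn; rewrite jn andbT.
by rewrite /q_image insubT; exists (Sub (val j).+1 lt).
Qed.

Fact q_image_rel u v :
  BB_rel u v -> \prod_(x <- u) q_image x = \prod_(x <- v) q_image x.
Proof.
have common w w' : common_rel w w' ->
    \prod_(x <- w) pgen Boo_rel x = \prod_(x <- w') pgen Boo_rel x.
  by move=> ww'; apply/pgen_rel/BooCommon.
have dist_gt1 (i j : q_index) (i' j' : s_index) : val i' = (val i).+1 ->
    val j' = (val j).+1 -> (`|val i - val j| > 1 -> `|val i' - val j'| > 1)%N.
  by move=> -> ->; rewrite -[(val i).+1]addn1 -[(val j).+1]addn1 distnDr.
have t_comm (i j : q_index) : val i = 1%N -> (`|val i - val j| > 1)%N ->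
    q_image i * q_image j = q_image j * q_image i.
  move=> i1; rewrite i1 => dij.
  have j_ge3 : (3 <= val j)%N.
    by move: dij (valP j); case: (val j) => [|[|[|m]]].
  have [j' j'E ->] := q_imageS (ltnW j_ge3); rewrite (q_image1 i1).
  have tC (t : 'I_2) : pgen Boo_rel (inl t) * pgen Boo_rel (inr j')
                     = pgen Boo_rel (inr j') * pgen Boo_rel (inl t).
    have j'_ge4 : (4 <= val j')%N by rewrite j'E.
    by have /common := STComm t j'_ge4; rewrite !big_cons !big_nil !mulg1.
  by rewrite -mulgA tC mulgA tC mulgA.
case=> {u v} [i j i1 j2|i j i2 ji|i j dij].
- have [j' j'E q_j] : exists2 j' : s_index, val j' = 3%N &
      q_image j = pgen Boo_rel (inr j').
    by have [|j'] := @q_imageS j; rewrite j2 //; exists j'.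
  have := pgen_rel (BooT j'E).
  rewrite !big_cons !big_nil !mulg1 (q_image1 i1) q_j => E.
  by rewrite !mulgA -!mulgA -E.
- have [i' i'E q_i] := q_imageS i2.
  have [|j' j'E q_j] := @q_imageS j; first by rewrite ji ltnW.
  have dij : `|val i' - val j'|%N = 1%N.
    by rewrite i'E j'E ji distnC distnEl ?subSnn.
  by have /common := @SBraid 'I_2 _ _ dij; rewrite !big_cons !big_nil q_i q_j.
- rewrite !big_cons !big_nil !mulg1.
  have [i1|i_gt1] : val i = 1%N \/ (1 < val i)%N.
    by have /andP[] := valP i; rewrite leq_eqVlt => /orP[/eqP<-|]; [left|right].
    by apply: t_comm.
  have [j1|j_gt1] : val j = 1%N \/ (1 < val j)%N.
    by have /andP[] := valP j; rewrite leq_eqVlt => /orP[/eqP<-|]; [left|right].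
    by apply: esym; apply: t_comm; rewrite // distnC.
  have [i' i'E ->] := q_imageS i_gt1; have [j' j'E ->] := q_imageS j_gt1.
  have /common := @SComm 'I_2 i' j' (dist_gt1 _ _ _ _ i'E j'E dij).
  by rewrite !big_cons !big_nil !mulg1.
Qed.

Definition BB_to_Boo : {multiplicative BB -> Boo} := plift q_image_rel.

Record group_under (A : groupType) := GroupUnder {
  gu_group :> groupType;
  gu_map : {multiplicative A -> gu_group}
}.

(* [tower m] is B(m + 1), with B(B_{n-1}) mapped to it through the last copy of
   B(oo,oo,n); by [amalgam_glue] any other copy gives the same map. *)
Fixpoint tower (m : nat) : group_under BB :=
  if m is m'.+1 then
    GroupUnder (amalgam_inr (gu_map (tower m')) BB_to_Boo \o BB_to_Boo)
  else GroupUnder BB_to_Boo.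

(* B(i); meaningful for i >= 1 *)
Definition iterated_amalgam (i : nat) : groupType := tower i.-1.

End BraidGroups.

(* Main.v *)
Require Import Defs.
From HB Require Import structures.
From mathcomp Require Import all_boot all_order ssralg ssrnum ssrint intdiv zify.
Set Implicit Arguments.
Unset Strict Implicit.
Unset Printing Implicit Defensive.
Import Order.TTheory GRing.Theory Num.Theory.
Local Open Scope group_scope.

(** Write d for t_1 t_0 in B(oo,oo,n). Setting t_(i+1) := d t_i^-1 and
t_(i-1) := t_i^-1 d extends t_0, t_1 to a sequence (t_i) indexed by the integers
in which any two consecutive terms satisfy t_(i+1) t_i = d, and every t_i
satisfies with the s_j the relations that t_0 and t_1 satisfy. For the braid
relation with s_3 this is the point of the relation (s_3 d)^2 = (d s_3)^2: if a
and b are consecutive in the sequence and braid with s_3, then either neighbour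
of the pair braids with s_3 exactly when that relation holds
([braided_above], [braided_below]).

In B^(k)(oo,oo,n) the relations t_i t_(i-k) = t_j t_(j-k) only relate indices in
the same residue class modulo k, apart from saying that the products are the
same for all classes. The generators t_(r+mk), m an integer, with the s_j thus
form a copy of B(oo,oo,n), one for each residue r; the s_j and d, that is the
image of B(B_(n-1)), are common to the k copies, and there are no further
relations. Hence B^(k)(oo,oo,n) is the universal group receiving k homomorphisms
from B(oo,oo,n) that agree on B(B_(n-1)) ([Bk_multi_amalgam]). By induction on k
the iterated amalgam is universal for the same problem
([tower_multi_amalgam]), and universal objects are isomorphic. *)

(** * Homomorphisms out of presented groups *)

Lemma morph1 (G H : groupType) (f : {multiplicative G -> H}) : f 1 = 1.
Proof. by apply: (mulgI (f 1)); rewrite -gmulfM !mulg1. Qed.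

Lemma morphV (G H : groupType) (f : {multiplicative G -> H}) :
  {morph f : x / x^-1}.
Proof. by move=> x; apply: (mulgI (f x)); rewrite -gmulfM !mulgV morph1. Qed.

Lemma presented_ext (X : choiceType) (R : relations X) (G : groupType)
    (f g : {multiplicative presented R -> G}) :
  (forall x, f (pgen R x) = g (pgen R x)) -> f =1 g.
Proof.
move=> fg x; rewrite -[x]wclassK; elim: (repr x) => {x} [|[y b] w IHw].
  by rewrite -[wclass R [::]]/(1 : presented R) !morph1.
have -> : wclass R ((y, b) :: w)
        = (if b then (pgen R y)^-1 else pgen R y) * wclass R w.
  by case: b; [rewrite -[_^-1]/(pinv _) wclassV|]; rewrite -[RHS]/(pmul _ _) wclassM.
by rewrite !gmulfM IHw; case: b; rewrite ?morphV fg.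
Qed.

(** * Amalgams of several copies of a group *)

Definition amalgam_inl (A G H : groupType) (phi : {multiplicative A -> G})
  (psi : {multiplicative A -> H}) (g : G) : amalgam phi psi :=
  pgen (amalgam_rel phi psi) (inl g).

Fact amalgam_inl_morph (A G H : groupType) (phi : {multiplicative A -> G})
  (psi : {multiplicative A -> H}) : {morph amalgam_inl phi psi : x y / x * y}.
Proof.
move=> x y; have := pgen_rel (AmalgL phi psi x y).
by rewrite big_cons !big_seq1 => /esym.
Qed.

HB.instance Definition _ (A G H : groupType) (phi : {multiplicative A -> G})
  (psi : {multiplicative A -> H}) :=
  isMultiplicative.Build G (amalgam phi psi) (amalgam_inl phi psi)
    (amalgam_inl_morph phi psi).

Lemma amalgam_lift (A G H K : groupType) (phi : {multiplicative A -> G})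
    (psi : {multiplicative A -> H}) (f : {multiplicative G -> K})
    (g : {multiplicative H -> K}) :
  (forall a, f (phi a) = g (psi a)) ->
  exists F : {multiplicative amalgam phi psi -> K},
    F \o amalgam_inl phi psi =1 f /\ F \o amalgam_inr phi psi =1 g.
Proof.
move=> fg; pose h (x : (G + H)%type) := match x with inl x => f x | inr y => g y end.
have hR u v : amalgam_rel phi psi u v -> \prod_(x <- u) h x = \prod_(x <- v) h x.
  by case=> *; rewrite !(big_cons, big_nil) !mulg1 /= ?gmulfM.
by exists (plift hR); split=> x; apply: plift_gen.
Qed.

Lemma amalgam_ext (A G H K : groupType) (phi : {multiplicative A -> G})
    (psi : {multiplicative A -> H}) (f g : {multiplicative amalgam phi psi -> K}) :
  f \o amalgam_inl phi psi =1 g \o amalgam_inl phi psi ->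
  f \o amalgam_inr phi psi =1 g \o amalgam_inr phi psi -> f =1 g.
Proof. by move=> fgl fgr; apply: presented_ext => -[x|x]; [apply: fgl|apply: fgr]. Qed.

Definition agree_on (A H G : groupType) (phi : {multiplicative A -> H}) (k : nat)
    (f : nat -> {multiplicative H -> G}) :=
  forall i j a, (i < k)%N -> (j < k)%N -> f i (phi a) = f j (phi a).

(** The universal property of the amalgam of k copies of H along phi : A -> H,
with [c 0], ..., [c k.-1] the inclusions of the copies. Indexing the copies by
nat, with arbitrary values from k on, spares casts between ordinal types when a
copy is added. *)
Definition multi_amalgam (A H P : groupType) (phi : {multiplicative A -> H})
    (k : nat) (c : nat -> {multiplicative H -> P}) : Prop :=
  [/\ agree_on phi k c,
      forall (G : groupType) (f : nat -> {multiplicative H -> G}),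
        agree_on phi k f ->
        exists F : {multiplicative P -> G}, forall i, (i < k)%N -> F \o c i =1 f i
    & forall (G : groupType) (F F' : {multiplicative P -> G}),
        (forall i, (i < k)%N -> F \o c i =1 F' \o c i) -> F =1 F'].

Lemma multi_amalgam_unique (A H P Q : groupType) (phi : {multiplicative A -> H})
    (k : nat) (c : nat -> {multiplicative H -> P})
    (d : nat -> {multiplicative H -> Q}) :
  multi_amalgam phi k c -> multi_amalgam phi k d -> isomorphic P Q.
Proof.
move=> [cA cF cU] [dA dF dU].
have [F Fc] := cF _ _ dA; have [F' F'd] := dF _ _ cA.
exists F; exists F' => x.
- apply: (cU _ (F' \o F) idfun) => i ik y /=.
  by rewrite [F _](Fc i ik) [F' _](F'd i ik).
- apply: (dU _ (F \o F') idfun) => i ik y /=.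
  by rewrite [F' _](F'd i ik) [F _](Fc i ik).
Qed.

Definition extend_copies (A H P : groupType) (phi : {multiplicative A -> H})
    (e : {multiplicative A -> P}) (k : nat) (c : nat -> {multiplicative H -> P})
    (i : nat) : {multiplicative H -> amalgam e phi} :=
  if i == k then (amalgam_inr e phi : {multiplicative H -> amalgam e phi})
  else (amalgam_inl e phi \o c i : {multiplicative H -> amalgam e phi}).

(** Homomorphisms from the amalgam of P and H over A are pairs of compatible
homomorphisms from P and H, and those from P are by assumption families of k
compatible homomorphisms from H. For k > 0, compatibility of the pair means
compatibility of the last member with any of the others. *)
Lemma multi_amalgam_step (A H P : groupType) (phi : {multiplicative A -> H})
    (k : nat) (c : nat -> {multiplicative H -> P}) (e : {multiplicative A -> P}) :
  (0 < k)%N -> multi_amalgam phi k c -> (forall i, (i < k)%N -> e =1 c i \o phi) ->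
  multi_amalgam phi k.+1 (extend_copies phi e k c).
Proof.
move=> k0 [cA cF cU] ec.
have old i : (i < k)%N -> extend_copies phi e k c i = amalgam_inl e phi \o c i
    :> {multiplicative H -> amalgam e phi}.
  by move=> ik; rewrite /extend_copies ltn_eqF.
have new : extend_copies phi e k c k = amalgam_inr e phi
    :> {multiplicative H -> amalgam e phi} by rewrite /extend_copies eqxx.
split.
- suff cr i a : (i < k.+1)%N -> extend_copies phi e k c i (phi a)
      = amalgam_inr e phi (phi a) by move=> i j a ik jk; rewrite !cr.
  rewrite ltnS leq_eqVlt => /orP[/eqP->|ik]; first by rewrite new.
  by rewrite old //= -[c i _](ec i ik a); apply: amalgam_glue.
- move=> G f fA.
  have [|F0 F0c] := cF G f.
    by move=> i j a ik jk; apply: fA; apply: ltnW.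
  have [a|F [Fl Fr]] := @amalgam_lift _ _ _ _ e phi F0 (f k).
    by rewrite (ec 0%N k0) [LHS](F0c 0%N k0); apply: fA.
  exists F => i; rewrite ltnS leq_eqVlt => /orP[/eqP->|ik] x.
    by rewrite new; apply: Fr.
  by rewrite old //= [LHS]Fl [LHS](F0c i ik).
- move=> G F F' FF'; apply: amalgam_ext => [|x].
    apply: (cU G (F \o amalgam_inl e phi) (F' \o amalgam_inl e phi)) => i ik x /=.
    by have := FF' i (ltnW ik) x; rewrite old.
  by have := FF' k (leqnn _) x; rewrite new.
Qed.

Lemma tower_multi_amalgam (n m : nat) :
  exists c : nat -> {multiplicative Boo n -> tower n m},
    multi_amalgam (BB_to_Boo n) m.+1 c /\
    gu_map (tower n m) =1 c m \o BB_to_Boo n.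
Proof.
elim: m => [|m [c [cP cm]]].
  exists (fun=> idfun : {multiplicative Boo n -> Boo n}); split=> //; split.
  - by [].
  - by move=> G f _; exists (f 0%N) => -[].
  - by move=> G F F' /(_ 0%N isT).
exists (extend_copies (BB_to_Boo n) (gu_map (tower n m)) m.+1 c); split.
  apply: multi_amalgam_step => // i im a; rewrite cm.
  by case: cP => cA _ _; apply: cA.
by move=> a; rewrite /= /extend_copies eqxx.
Qed.

(** * Bi-infinite sequences with constant consecutive products *)

Definition braided (G : groupType) (x y : G) := x * y * x = y * x * y.

(** Right multiplication by b s a turns the two sides of the braid relation
between s and c into the two sides of the second relation, using only the three
hypotheses: s c s b s a = s c b s b a = s b a s b a and
c s c b s a = c s b a s a = c s b s a s = c b s b a s = b a s b a s. *)
Lemma braided_above (G : groupType) (s a b c : G) :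
  braided s a -> braided s b -> c * b = b * a ->
  braided s c <->
  s * (b * a) * s * (b * a) = b * a * s * (b * a) * s.
Proof.
rewrite /braided => sa sb cb.
have sbz z : s * (b * (s * z)) = b * (s * (b * z)) by rewrite !mulgA sb.
have cbz z : c * (b * z) = b * (a * z) by rewrite !mulgA cb.
have L : s * c * s * (b * s * a) = s * (b * a) * s * (b * a).
  by rewrite -!mulgA sbz cbz.
have R : c * s * c * (b * s * a) = b * a * s * (b * a) * s.
  by rewrite -!mulgA cbz (mulgA a s a) -sa -!mulgA sbz cbz.
by rewrite -L -R; split=> [->|/mulIg].
Qed.

(** The mirror image of the previous lemma, with left multiplication by b s a. *)
Lemma braided_below (G : groupType) (s a b c : G) :
  braided s a -> braided s b -> a * c = b * a ->
  braided s c <->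
  s * (b * a) * s * (b * a) = b * a * s * (b * a) * s.
Proof.
rewrite /braided => sa sb ac.
have saz z : a * (s * (a * z)) = s * (a * (s * z)) by rewrite !mulgA sa.
have sbz z : b * (s * (b * z)) = s * (b * (s * z)) by rewrite !mulgA sb.
have acz z : a * (c * z) = b * (a * z) by rewrite !mulgA ac.
have L : b * s * a * (s * c * s) = b * a * s * (b * a) * s.
  by rewrite -!mulgA -saz acz.
have R : b * s * a * (c * s * c) = s * (b * a) * s * (b * a).
  by rewrite -!mulgA acz sbz -saz ac.
by rewrite -L -R; split=> [->|/mulgI].
Qed.

Definition zigzag (G : groupType) (d : G) (x : int -> G) :=
  forall i : int, x (i + 1)%R * x i = d.

(** Two consecutive terms determine both neighbours of the pair, so what holds at
two consecutive indices and passes from a pair to its neighbours holds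
everywhere. *)
Lemma zigzag_ind (G : groupType) (d : G) (x : int -> G) (P : G -> Prop) :
  zigzag d x -> P (x 0%R) -> P (x 1%R) ->
  (forall a b c, P a -> P b -> b * a = d -> c * b = d -> P c) ->
  (forall a b c, P a -> P b -> b * a = d -> a * c = d -> P c) ->
  forall i, P (x i).
Proof.
move=> xd P0 P1 up down i; suff [] : P (x i) /\ P (x (i + 1)%R) by [].
elim: i => [|m [Pm PSm]|m [Pm PSm]]; first by rewrite add0r.
- have e : (m.+1%:Z = m%:Z + 1)%R by lia.
  by rewrite e; split=> //; apply: up Pm PSm (xd _) (xd _).
- have e : (- m.+1%:Z + 1 = - m%:Z)%R by lia.
  by rewrite e; split=> //; apply: down Pm PSm (xd _) _; rewrite -[in x (- _)%R]e xd.
Qed.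

Lemma zigzag_inj (G : groupType) (d : G) (x y : int -> G) :
  zigzag d x -> zigzag d y -> x 0%R = y 0%R -> x =1 y.
Proof.
move=> xd yd xy0; elim=> [//|m IHm|m IHm].
- have e : (m.+1%:Z = m%:Z + 1)%R by lia.
  by apply: (mulIg (x (Posz m))); rewrite {2}IHm e xd yd.
- have e : (- m%:Z = - m.+1%:Z + 1)%R by lia.
  by apply: (mulgI (x (- m%:Z)%R)); rewrite {2}IHm e xd yd.
Qed.

Definition zigzag_of (G : groupType) (d a : G) (i : int) : G :=
  match i with
  | Posz m => iter m (fun x => d * x^-1) a
  | Negz m => iter m.+1 (fun x => x^-1 * d) a
  end.

Lemma zigzag_ofP (G : groupType) (d a : G) : zigzag d (zigzag_of d a).
Proof.
case=> m.
  have -> : (m%:Z + 1 = m.+1%:Z)%R by lia.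
  by rewrite /= mulgVK.
have -> : (Negz m + 1 = - m%:Z)%R by lia.
by case: m => [|m] /=; rewrite mulVKg.
Qed.

(** * The sequence of generators of B(oo,oo,n) *)

Local Notation prodE := (big_cons, big_nil, mulg1, mulgA).

Definition boo_s (n : nat) (j : s_index n) : Boo n := pgen (Boo_rel (n := n)) (inr j).
Definition boo_t (n : nat) (i : 'I_2) : Boo n := pgen (Boo_rel (n := n)) (inl i).
Definition boo_delta (n : nat) : Boo n := boo_t n ord_max * boo_t n ord0.
Definition boo_tz (n : nat) (i : int) : Boo n :=
  zigzag_of (boo_delta n) (boo_t n ord0) i.

Lemma boo_tz_zigzag (n : nat) : zigzag (boo_delta n) (boo_tz n).
Proof. exact: zigzag_ofP. Qed.

Lemma boo_tzE (n : nat) (i : 'I_2) : boo_tz n i%:Z%R = boo_t n i.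
Proof.
case: i => -[|[|//]] p /=; rewrite /boo_tz /= /boo_delta ?mulgK;
  by congr boo_t; apply: val_inj.
Qed.

Lemma boo_common (n : nat) u v : common_rel u v ->
  \prod_(x <- u) pgen (Boo_rel (n := n)) x = \prod_(x <- v) pgen (Boo_rel (n := n)) x.
Proof. by move=> uv; apply/pgen_rel/BooCommon. Qed.

(** The half of the equivalence between the two presentations of B(oo,oo,n) that
produces infinitely many braid relations from finitely many. *)
Lemma boo_tz_braided (n : nat) (j : s_index n) (i : int) :
  val j = 3%N -> braided (boo_s j) (boo_tz n i).
Proof.
move=> j3; have bt e : braided (boo_s j) (boo_t n e).
  by have := boo_common (STBraid e j3); rewrite !prodE.
have rel := pgen_rel (BooT j3); rewrite !prodE in rel.
apply: (zigzag_ind (@boo_tz_zigzag n)).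
- exact: bt.
- by rewrite (boo_tzE n ord_max).
- by move=> a b c sa sb ba cb; apply/(braided_above sa sb); rewrite ?cb ba // !mulgA.
- by move=> a b c sa sb ba ac; apply/(braided_below sa sb); rewrite ?ac ba // !mulgA.
Qed.

Lemma boo_tz_comm (n : nat) (j : s_index n) (i : int) :
  (4 <= val j)%N -> commute (boo_s j) (boo_tz n i).
Proof.
move=> j4; have ct e : commute (boo_s j) (boo_t n e).
  by have := boo_common (STComm e j4); rewrite !prodE.
have cd : commute (boo_s j) (boo_delta n) by apply: commuteM.
apply: (zigzag_ind (@boo_tz_zigzag n)).
- exact: ct.
- by rewrite (boo_tzE n ord_max).
- move=> a b c sa sb _ cb.
  by rewrite -(mulgK b c) cb; apply: commuteM => //; apply: commuteV.
- move=> a b c sa sb _ ac.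
  by rewrite -(mulKg a c) ac; apply: commuteM => //; apply: commuteV.
Qed.

(** The element d and the s_j come from B(B_(n-1)), so homomorphisms that agree
there take the same values on them. *)
Lemma boo_delta_BB (n : nat) : (2 <= n)%N -> exists a, BB_to_Boo n a = boo_delta n.
Proof.
move=> n2; exists (pgen (BB_rel (n := n)) (Sub 1%N n2)).
by rewrite plift_gen q_image1.
Qed.

Lemma boo_s_BB (n : nat) (j : s_index n) : exists a, BB_to_Boo n a = boo_s j.
Proof.
case: j => -[//|j] pj; have qj : (1 <= j < n)%N by case/andP: pj => /ltnW; rewrite ltnS => ->.
exists (pgen (BB_rel (n := n)) (Sub j qj)).
by rewrite plift_gen /q_image insubT.
Qed.

(** * The copies of B(oo,oo,n) in B^(k)(oo,oo,n) *)

Definition bk_s (n : nat) (k : int) (j : s_index n) : Bk n k :=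
  pgen (Bk_rel (n := n) k) (inr j).
Definition bk_t (n : nat) (k i : int) : Bk n k := pgen (Bk_rel (n := n) k) (inl i).

Lemma bk_common (n : nat) (k : int) u v : common_rel u v ->
  \prod_(x <- u) pgen (Bk_rel (n := n) k) x = \prod_(x <- v) pgen (Bk_rel (n := n) k) x.
Proof. by move=> uv; apply/pgen_rel/BkCommon. Qed.

(** The constant product is written t_k t_0 for every residue r. *)
Lemma bk_t_zigzag (n : nat) (k r : int) :
  zigzag (bk_t n k k * bk_t n k 0%R) (fun m => bk_t n k (r + m * k)%R).
Proof.
move=> m; have := pgen_rel (BkT n k (r + (m + 1) * k)%R k); rewrite !prodE subrr.
by have -> : (r + (m + 1) * k - k = r + m * k)%R by lia.
Qed.

Definition copy_gen (n : nat) (k r : int) (x : 'I_2 + s_index n) : Bk n k :=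
  match x with
  | inl i => bk_t n k (r + i%:Z * k)%R
  | inr j => bk_s k j
  end.

(** The relation (s_3 d)^2 = (d s_3)^2, the only one that is not immediate, holds
because t_r, t_(r+k) and t_(r+2k) all braid with s_3. *)
Fact copy_gen_rel (n : nat) (k r : int) u v : Boo_rel u v ->
  \prod_(x <- u) @copy_gen n k r x = \prod_(x <- v) @copy_gen n k r x.
Proof.
case=> {u v} [u v [i j ij|i j ij|j i j3|j i j4]|j j3].
- by have := bk_common k (SBraid int ij); rewrite !prodE.
- by have := bk_common k (SComm int ij); rewrite !prodE.
- by have := bk_common k (STBraid (r + i%:Z * k)%R j3); rewrite !prodE.
- by have := bk_common k (STComm (r + i%:Z * k)%R j4); rewrite !prodE.
- have bt m : braided (bk_s k j) (bk_t n k (r + m * k)%R).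
    by have := bk_common k (STBraid (r + m * k)%R j3); rewrite !prodE.
  have z := @bk_t_zigzag n k r.
  have /(braided_above (bt 0%R) (bt 1%R)) : bk_t n k (r + (1 + 1) * k)%R
      * bk_t n k (r + 1 * k)%R = bk_t n k (r + 1 * k)%R * bk_t n k (r + 0 * k)%R.
    by rewrite z -{1}(add0r 1%R) z.
  by move=> [/(_ (bt _))]; rewrite !prodE.
Qed.

Definition copy (n : nat) (k r : int) : {multiplicative Boo n -> Bk n k} :=
  plift (@copy_gen_rel n k r).

Lemma copy_s (n : nat) (k r : int) (j : s_index n) : copy n k r (boo_s j) = bk_s k j.
Proof. exact: plift_gen. Qed.

Lemma copy_t (n : nat) (k r : int) (i : 'I_2) :
  copy n k r (boo_t n i) = bk_t n k (r + i%:Z * k)%R.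
Proof. exact: plift_gen. Qed.

Lemma copy_delta (n : nat) (k r : int) :
  copy n k r (boo_delta n) = bk_t n k k * bk_t n k 0%R.
Proof. by rewrite gmulfM !copy_t -[RHS](@bk_t_zigzag n k r 0%R) add0r. Qed.

Lemma copy_tz (n : nat) (k r m : int) :
  copy n k r (boo_tz n m) = bk_t n k (r + m * k)%R.
Proof.
move: m; apply: zigzag_inj (@bk_t_zigzag n k r) _ => [m|]; last exact: copy_t.
by rewrite -gmulfM boo_tz_zigzag copy_delta.
Qed.

Lemma copy_BB (n : nat) (k r r' : int) :
  copy n k r \o BB_to_Boo n =1 copy n k r' \o BB_to_Boo n.
Proof.
apply: presented_ext => q /=; rewrite -![BB_to_Boo n _]/(plift _ _) !plift_gen /q_image.
by case: insubP => [j _ _|_]; [rewrite !copy_s|rewrite !copy_delta].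
Qed.

(** A compatible family (f_r) extends to B^(k)(oo,oo,n) by t_(r+mk) |-> f_r(t_m)
for 0 <= r < k. The relations between the t_i hold since all products
t_i t_(i-k) go to the common value of the f_r at d. *)
Lemma Bk_multi_amalgam (n k : nat) : (2 <= n)%N -> (0 < k)%N ->
  multi_amalgam (BB_to_Boo n) k (fun r : nat => copy n k%:Z%R r%:Z%R).
Proof.
move=> n2 k0; have kz : (k%:Z != 0 :> int)%R by rewrite -lt0n.
split=> [i j a _ _|G f fA|G F F' FF']; first exact: (copy_BB k%:Z%R i%:Z%R j%:Z%R a).
- pose h (x : int + s_index n) : G := match x with
    | inl i => f `|(i %% k%:Z)%Z|%N (boo_tz n (i %/ k%:Z)%Z)
    | inr j => f 0%N (boo_s j)
    end.
  have lt i : (`|(i %% k%:Z)%Z| < k)%N by lia.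
  have fs i j : (i < k)%N -> f i (boo_s j) = f 0%N (boo_s j).
    by have [a <-] := boo_s_BB j => ik; apply: fA.
  have fd i : (i < k)%N -> f i (boo_delta n) = f 0%N (boo_delta n).
    by have [a <-] := boo_delta_BB n2 => ik; apply: fA.
  have hR u v : Bk_rel k%:Z%R u v -> \prod_(x <- u) h x = \prod_(x <- v) h x.
    case=> {u v} [u v [i j ij|i j ij|j i j3|j i j4]|i j]; rewrite !prodE /=.
    + have := boo_common (SBraid 'I_2 ij); rewrite !prodE => e.
      by rewrite -!gmulfM e.
    + have := boo_common (SComm 'I_2 ij); rewrite !prodE => e.
      by rewrite -!gmulfM e.
    + by rewrite -(fs _ j (lt i)) -!gmulfM boo_tz_braided.
    + by rewrite -(fs _ j (lt i)) -!gmulfM boo_tz_comm.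
    + suff hd i' : h (inl i') * h (inl (i' - k%:Z)%R) = f 0%N (boo_delta n) by rewrite !hd.
      (* Replacing i' by i' - k keeps the residue and lowers the quotient by 1. *)
      have iE : (i' - k%:Z = -1 * k%:Z + i')%R by lia.
      have qE : ((i' - k%:Z)%R %/ k%:Z)%Z = ((i' %/ k%:Z)%Z - 1)%R.
        by rewrite iE divzMDl ?kz // addrC.
      have mE : ((i' - k%:Z)%R %% k%:Z)%Z = (i' %% k%:Z)%Z by rewrite iE modzMDl.
      rewrite /= qE mE -gmulfM -(fd _ (lt i')); congr (f _ _).
      by rewrite -[X in boo_tz _ X * _](subrK 1%R) boo_tz_zigzag.
  exists (plift hR) => i ik; apply: presented_ext => -[t|j].
    rewrite -[LHS]/(plift hR (copy n k%:Z%R i%:Z%R (boo_t n t))) -[pgen _ _]/(boo_t n t).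
    rewrite copy_t plift_gen /h -boo_tzE.
    have -> : ((i%:Z + t%:Z * k%:Z)%R %/ k%:Z)%Z = t%:Z%R.
      by rewrite addrC divzMDl // divz_small ?addr0.
    by have -> : `|((i%:Z + t%:Z * k%:Z)%R %% k%:Z)%Z|%N = i by rewrite addrC modzMDl modz_small.
  rewrite -[LHS]/(plift hR (copy n k%:Z%R i%:Z%R (boo_s j))) -[pgen _ _]/(boo_s j).
  by rewrite copy_s plift_gen /h fs.
apply: presented_ext => -[i|j].
  rewrite -[pgen _ _]/(bk_t n k%:Z%R i).
  have -> : bk_t n k%:Z%R i = copy n k%:Z%R `|(i %% k%:Z)%Z|%N (boo_tz n (i %/ k%:Z)%Z).
    by rewrite copy_tz; congr bk_t; lia.
  by apply: FF'; lia.
rewrite -[pgen _ _]/(bk_s k%:Z%R j) -(copy_s k%:Z%R 0%R).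
exact: FF' k0 _.
Qed.

(** * The isomorphism *)

Theorem proposition5p7 (n k : nat) (n_ge2 : (2 <= n)%N) (k_ge2 : (2 <= k)%N) :
  isomorphic (Bk n k%:Z%R) (iterated_amalgam n k).
Proof.
have k_gt0 : (0 < k)%N by apply: ltnW.
have [c []] := tower_multi_amalgam n k.-1; rewrite prednK // => cP _.
exact: multi_amalgam_unique (Bk_multi_amalgam n_ge2 k_gt0) cP.
Qed.
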